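(* Let $N\ge1$, let $c\in\mathbb{C}^N$ be unimodular (i.e. $|c[h]|=1$ for all $h$), and let $\varphi\in\mathbb{C}^{N^2}$ be the square length Björck–Saffari sequence generated by $c$ and the identity permutation $\sigma(h)=h$. Let $a,b,N'$ be positive integers with $\gcd(a,b)=1$ and $N^2=abN'$, and let $K=\{0,a,\dots,(bN'-1)a\}$ and $L=\{0,b,\dots,(aN'-1)b\}$, viewed as subgroups of $\mathbb{Z}/N^2\mathbb{Z}$. Then the Gabor system $(\varphi,K\times L)$ is a tight Gabor frame for $\mathbb{C}^{N^2}$ with frame bound $N^2N'$.
   Context: For a positive integer $D$ (here $D=N^2$), vectors in $\mathbb{C}^D$ are indexed by $\mathbb{Z}/D\mathbb{Z}$, and $\langle x,y\rangle=\sum_j x[j]\overline{y[j]}$. Translation and modulation are $\tau_k(\varphi)[j]=\varphi[j-k]$ and $e_\ell(\varphi)[j]=e^{2\pi i j\ell/D}\varphi[j]$. For $\Lambda\subseteq(\mathbb{Z}/D\mathbb{Z})\times(\mathbb{Z}/D\mathbb{Z})$ (pairs (translation, modulation)), the Gabor system is the family $(\varphi,\Lambda)=\{e_\ell\tau_k\varphi:(k,\ell)\in\Lambda\}$, indexed by $\Lambda$. A finite family $\{v_i\}$ in $\mathbb{C}^D$ is a tight frame with frame bound $A>0$ if $\sum_i|\langle x,v_i\rangle|^2=A\|x\|_2^2$ for all $x\in\mathbb{C}^D$. Given a unimodular $c\in\mathbb{C}^N$ and a permutation $\sigma$ of $\{0,\dots,N-1\}$, the square length Björck–Saffari sequence $\varphi\in\mathbb{C}^{N^2}$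 is defined by $\varphi[rN+h]=c[h]\,e^{2\pi i r\sigma(h)/N}$ for $r,h\in\{0,\dots,N-1\}$. *)

(* Defs.v *)
From mathcomp Require Import all_boot all_order all_algebra all_fingroup.
From mathcomp Require Import reals trigo.
From mathcomp Require Import complex.

Set Implicit Arguments.
Unset Strict Implicit.
Unset Printing Implicit Defensive.

Import Order.TTheory GRing.Theory Num.Theory.
Local Open Scope ring_scope.
Local Open Scope complex_scope.

(* For D > 0 this is Z/DZ with its additive group structure; unlike 'Z_D it is
   the trivial group for D = 1. The class of n : nat is inZp n, and the coercion
   to nat picks the representative in {0, ..., D - 1}. *)
Notation Zmod D := 'I_D.-1.+1.

Section Gabor.
Variable R : realType.

(* e^{it} *)
Definition expi (t : R) : R[i] := cos t +i* sin t.

Definition inner D (x y : Zmod D -> R[i]) : R[i] := \sum_j x j * (y j)^*.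

Definition norm2 D (x : Zmod D -> R[i]) : R[i] := sqrtC (\sum_j `|x j| ^+ 2).

Definition translation D (k : Zmod D) (phi : Zmod D -> R[i]) : Zmod D -> R[i] :=
  fun j => phi (j - k).

Definition modulation D (l : Zmod D) (phi : Zmod D -> R[i]) : Zmod D -> R[i] :=
  fun j => expi (2 * pi * (j * l)%N%:R / D%:R) * phi j.

(* The member of the Gabor system of phi indexed by p = (translation,
   modulation); the system (phi, Lambda) is this family restricted to Lambda. *)
Definition gabor D (phi : Zmod D -> R[i]) (p : Zmod D * Zmod D) :
    Zmod D -> R[i] :=
  modulation p.2 (translation p.1 phi).

Definition tight_frame D (I : finType) (Lambda : {set I})
    (v : I -> Zmod D -> R[i]) (A : R) : Prop :=
  0 < A /\
  forall x : Zmod D -> R[i],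
    \sum_(i in Lambda) `|inner x (v i)| ^+ 2 = A%:C * norm2 x ^+ 2.

(* The index j = r N + h has r = j %/ N and h = j %% N. *)
Definition bjorck_saffari N (c : Zmod N -> R[i]) (sigma : {perm (Zmod N)}) :
    Zmod (N ^ 2) -> R[i] :=
  fun j => let h := inZp j in
    c h * expi (2 * pi * ((j %/ N) * sigma h)%N%:R / N%:R).

Lemma bjorck_saffariE N (c : Zmod N -> R[i]) (sigma : {perm (Zmod N)})
    (r h : Zmod N) : (0 < N)%N ->
  bjorck_saffari c sigma (inZp (r * N + h)) =
  c h * expi (2 * pi * (r * sigma h)%N%:R / N%:R).
Proof.
case: N c sigma r h => // n c sigma r h _; rewrite /bjorck_saffari /=.
have hlt : (h < n.+1)%N by exact: ltn_ord.
have lt2 : (r * n.+1 + h < n.+1 ^ 2)%N.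
  rewrite -mulnn (leq_trans (n := r.+1 * n.+1)) //.
    by rewrite mulSn addnC ltn_add2r.
  by rewrite leq_mul2r ltn_ord orbT.
have -> : ((r * n.+1 + h) %% (n.+1 ^ 2).-1.+1 = r * n.+1 + h)%N.
  by rewrite modn_small // prednK ?expn_gt0.
have -> : inZp (r * n.+1 + h) = h :> 'I_n.+1.
  by apply/val_inj; rewrite /= modnMDl modn_small.
by rewrite divnMDl // divn_small // addn0.
Qed.

End Gabor.

(* {0, a, ..., (m - 1) a}, a subgroup of Z/DZ when D = m a *)
Definition multiples D (a m : nat) : {set Zmod D} :=
  [set inZp (i * a)%N | i : 'I_m].

(* Main.v *)
Require Import Defs.
From mathcomp Require Import all_boot all_order all_algebra all_fingroup.
From mathcomp Require Import reals trigo.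
From mathcomp Require Import complex ring lra.

(** Write D = N^2 and w = e^(2 pi i / D).  The Gram kernel
    sum_(k in K, l in L) conj (g_(k,l)(j)) g_(k,l)(j + s) factors as a character
    sum over L times a sum over k in K of the correlation
    j |-> conj (phi j) phi (j + s) at j - k.  For s <> 0 one factor vanishes.
    The sum over L vanishes unless D | b s.  If D | b s, use
    phi(j + t N) = phi(j) w^(t N j): moving j by a multiple u of N multiplies the
    correlation by w^(u s), and when N | s it equals w^(s j), so that then any
    u will do.  If N | s, shifting by a gives the factor w^(a s), which is 1 only
    if D divides both a s and b s, hence s.  If not, shifting by a N gives the
    factor w^(a N s), which is 1 only if N divides both a s and b s, hence s. *)

Set Implicit Arguments.
Unset Strict Implicit.
Unset Printing Implicit Defensive.

Import Order.TTheory GRing.Theory Num.Theory.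
Local Open Scope ring_scope.
Local Open Scope complex_scope.

(** * Roots of unity as complex exponentials *)

Section UnitRoots.
Variable R : realType.
Implicit Types (s t : R) (D m : nat).

Lemma expi0 : expi 0 = 1 :> R[i].
Proof. by rewrite /expi cos0 sin0. Qed.

Lemma expiD s t : expi (s + t) = expi s * expi t.
Proof. by rewrite /expi cosD sinD; apply/eqP; rewrite eq_complex /= eqxx addrC eqxx. Qed.

Lemma expiMn t m : expi (t *+ m) = expi t ^+ m.
Proof. by elim: m => [|m IHm]; rewrite ?mulr0n ?expi0 // mulrS exprS expiD IHm. Qed.

Lemma norm_expi t : `|expi t| = 1.
Proof. by rewrite normc_def /= cos2Dsin2 sqrtr1. Qed.

Lemma expi_2pi : expi (2 * pi) = 1 :> R[i].
Proof. by rewrite /expi mulr_natl cos2pi sin2pi. Qed.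

(** The half angle lies in [(0, pi)], where the sine is positive, and
    [cos t = 1 - 2 sin^2 (t / 2)]. *)
Lemma expi_neq1 t : 0 < t < 2 * pi -> expi t != 1.
Proof.
move=> /andP[t_gt0 t_lt]; have sin_gt0 : 0 < sin (t / 2).
  by rewrite sin_gt0_pi // divr_gt0 //= ltr_pdivrMr // mulrC.
apply/eqP => -[+ _]; rewrite {1}[t](splitr) -mulr2n cos_mulr2n cos2sin2 => cos_eq1.
have /eqP : sin (t / 2) ^+ 2 = 0 by lra.
by rewrite sqrf_eq0 gt_eqF.
Qed.

Definition zeta D : R[i] := expi (2 * pi / D%:R).

Lemma expi_zeta D m : expi (2 * pi * m%:R / D%:R) = zeta D ^+ m.
Proof. by rewrite -expiMn mulrAC mulr_natr. Qed.

Lemma norm_zeta D : `|zeta D| = 1.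
Proof. exact: norm_expi. Qed.

Lemma zeta_prim D : (0 < D)%N -> D.-primitive_root (zeta D).
Proof.
move=> D_gt0; rewrite /primitive_root_of_unity D_gt0 /=.
apply/forallP => i; rewrite unity_rootE -expi_zeta.
have D_pos : 0 < D%:R :> R by rewrite ltr0n.
have [->|neq] := eqVneq i.+1 D; first by rewrite mulfK ?lt0r_neq0 // expi_2pi !eqxx.
rewrite (negPf (expi_neq1 _)) // divr_gt0 ?mulr_gt0 ?pi_gt0 ?ltr0n //=.
by rewrite ltr_pdivrMr // ltr_pM2l ?mulr_gt0 ?pi_gt0 // ltr_nat ltn_neqAle neq ltn_ord.
Qed.

(** With [m = D = N] this turns the [N]-th roots of unity that define the sequence into powers of
    [w]. *)
Lemma zetaX m D : (0 < m)%N -> zeta (m * D) ^+ m = zeta D.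
Proof.
move=> m_gt0; rewrite -expi_zeta natrM invfM mulrA mulfK //.
by rewrite pnatr_eq0 -lt0n.
Qed.

End UnitRoots.

(** * Subgroups generated by a divisor of the modulus *)

Section Multiples.
Variables (D a m : nat) (D_gt0 : (0 < D)%N) (Dma : D = (m * a)%N).

Let step_gt0 : (0 < a)%N.
Proof. by move: D_gt0; rewrite Dma muln_gt0 => /andP[]. Qed.

Let modulusE : D.-1.+1 = D. Proof. exact: prednK. Qed.

Let val_multiple (i : 'I_m) : @inZp D.-1 (i * a) = (i * a)%N :> nat.
Proof. by rewrite /= modulusE modn_small // Dma ltn_pmul2r. Qed.

(** The products [i * a] with [i < m] stay below [D = m * a], so reduction modulo [D] leaves them
    unchanged. *)
Lemma mem_multiples (k : Zmod D) : (k \in multiples D a m) = (a %| k)%N.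
Proof.
apply/imsetP/idP => [[i _ ->]|/dvdnP[q kE]]; first by rewrite val_multiple dvdn_mull.
have q_lt : (q < m)%N by rewrite -(ltn_pmul2r step_gt0) -kE -Dma -[ltnRHS]modulusE ltn_ord.
by exists (Ordinal q_lt) => //; apply/ord_inj; rewrite val_multiple -kE.
Qed.

Lemma card_multiples : #|multiples D a m| = m.
Proof.
rewrite card_imset ?card_ord // => i j /(congr1 (@nat_of_ord _)) /eqP.
by rewrite !val_multiple eqn_pmul2r // => /eqP /val_inj.
Qed.

Lemma multiplesD (u k : Zmod D) :
  u \in multiples D a m -> (k + u \in multiples D a m) = (k \in multiples D a m).
Proof.
have a_dvd : (a %| D.-1.+1)%N by rewrite modulusE Dma dvdn_mull.
rewrite !mem_multiples => a_u.
by rewrite /= /dvdn (modn_dvdm _ a_dvd) -!/(dvdn _ _) dvdn_addl.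
Qed.

Lemma multiplesN (u : Zmod D) :
  u \in multiples D a m -> - u \in multiples D a m.
Proof. by move=> uM; rewrite -(multiplesD _ uM) addNr mem_multiples dvdn0. Qed.

Lemma mem_multiples_inZp t : (a %| t)%N -> inZp t \in multiples D a m.
Proof.
have a_dvd : (a %| D.-1.+1)%N by rewrite modulusE Dma dvdn_mull.
by rewrite mem_multiples /= /dvdn (modn_dvdm _ a_dvd).
Qed.

(** Translation by [u] permutes the subgroup, so the sum [S] satisfies [S = z * S]. *)
Lemma sum_multiples_eq0 (C : fieldType) (f : Zmod D -> C) (u : Zmod D) (z : C) :
    u \in multiples D a m -> z != 1 -> (forall k, f (k + u) = z * f k) ->
  \sum_(k in multiples D a m) f k = 0.
Proof.
move=> uM z_neq1 fD; apply/eqP; set S := \sum_(k in _) _.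
have : S = z * S.
  rewrite {1}/S (reindex_inj (addIr u)) mulr_sumr.
  by apply: eq_big => k; rewrite ?multiplesD.
move/eqP; rewrite -subr_eq0 -{1}[S]mul1r -mulrBl mulf_eq0 subr_eq0 eq_sym.
by rewrite (negPf z_neq1).
Qed.

End Multiples.

(** * Björck-Saffari sequences and their Gram kernel *)

Section BjorckSaffari.
Variables (R : realType) (N : nat) (N_gt0 : (0 < N)%N) (c : Zmod N -> R[i]).
Hypothesis c_unimod : forall h, `|c h| = 1.
Let D := (N ^ 2)%N.
Let phi := bjorck_saffari c (1%g : {perm (Zmod N)}).
Let w : R[i] := zeta R D.

Let D_gt0 : (0 < D)%N. Proof. by rewrite expn_gt0 N_gt0. Qed.
Let modulusE : D.-1.+1 = D. Proof. exact: prednK. Qed.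
Let DE : D = (N * N)%N. Proof. by rewrite mulnn. Qed.
Let w_prim : D.-primitive_root w. Proof. exact: zeta_prim. Qed.
(** The modulus is spelled here as it appears when operations of [Zmod D] reduce. *)
Let w_prim1 : D.-1.+1.-primitive_root w. Proof. by rewrite modulusE. Qed.

Lemma norm_bjorck_saffari j : `|phi j| = 1.
Proof. by rewrite normrM c_unimod norm_expi mulr1. Qed.

(** Here [m] need not be below [D]: lowering it by [D] lowers [m %/ N] by [N], hence the exponent by
    a multiple of [N * N = D]. *)
Lemma bjorck_saffari_inZp m :
  phi (inZp m) = c (inZp m) * w ^+ (N * (m %/ N * (m %% N))).
Proof.
have -> : phi (inZp m) =
    c (inZp (m %% D)) * expi (2 * pi * (m %% D %/ N * (m %% D %% N))%N%:R / N%:R).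
  by rewrite /phi /bjorck_saffari perm1 /= modulusE prednK.
have cE : inZp (m %% D) = inZp m :> Zmod N.
  by apply/val_inj; rewrite /= prednK // modn_dvdm // DE dvdn_mulr.
rewrite cE expi_zeta -(zetaX R N N_gt0) mulnn -/D -/w -exprM.
congr (_ * _); apply/eqP; rewrite (eq_prim_root_expr w_prim); apply/eqP.
have m_divE : (m %/ N = m %/ D * N + m %% D %/ N)%N.
  by rewrite [in LHS](divn_eq m D) {2}DE mulnA divnMDl.
have m_modE : (m %% N = m %% D %% N)%N by rewrite modn_dvdm // DE dvdn_mulr.
rewrite m_divE m_modE.
have -> : (N * ((m %/ D * N + m %% D %/ N) * (m %% D %% N)) =
    m %/ D * (m %% D %% N) * D + N * (m %% D %/ N * (m %% D %% N)))%N.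
  by rewrite {6}DE; ring.
by rewrite modnMDl.
Qed.

(** Adding [t * N] keeps the residue [h] modulo [N] and raises the quotient by [t], which
    contributes [w ^+ (t * N * h)]; since [N * N = D], [h] may be replaced by [m]. *)
Lemma bjorck_saffariD t m :
  phi (inZp (m + t * N)) = phi (inZp m) * w ^+ (t * N * m).
Proof.
rewrite !bjorck_saffari_inZp.
have -> : inZp (m + t * N) = inZp m :> Zmod N.
  by apply/val_inj; rewrite /= prednK // addnC modnMDl.
rewrite -mulrA -exprD; congr (_ * _).
apply/eqP; rewrite (eq_prim_root_expr w_prim); apply/eqP.
have -> : (N * ((m + t * N) %/ N * ((m + t * N) %% N)) =
    N * (m %/ N * (m %% N)) + t * N * (m %% N))%N.
  by rewrite addnC modnMDl divnMDl //; ring.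
have -> : (t * N * m = t * (m %/ N) * D + t * N * (m %% N))%N.
  by rewrite {1}(divn_eq m N) DE; ring.
by rewrite addnCA modnMDl.
Qed.

Lemma bjorck_saffari_shift (u j : Zmod D) : (N %| u)%N ->
  phi (j + u) = phi j * w ^+ (u * j).
Proof.
move=> /dvdnP[t uE]; have -> : j + u = inZp (j + t * N) by apply/ord_inj; rewrite /= -uE.
by rewrite bjorck_saffariD -uE valZpK.
Qed.

Lemma zetaX_modD (x y : Zmod D) m : w ^+ (m * (x + y)%R) = w ^+ (m * x) * w ^+ (m * y).
Proof.
rewrite -exprD -mulnDr; apply/eqP; rewrite (eq_prim_root_expr w_prim1) /=.
by rewrite modnMmr.
Qed.

Lemma conj_unimod (z : R[i]) : `|z| = 1 -> Num.conj z * z = 1.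
Proof. by move=> z1; rewrite mulrC -normCK z1 expr1n. Qed.

Let corr (s j : Zmod D) := Num.conj (phi j) * phi (j + s).

(** The two factors of the correlation gain the phases [w ^+ (u * j)], conjugated, and
    [w ^+ (u * (j + s))]; their product is free of [j]. *)
Lemma corr_shift (s u j : Zmod D) : (N %| u)%N ->
  corr s (j + u) = w ^+ (u * s) * corr s j.
Proof.
move=> N_u; rewrite /corr addrAC 2?(bjorck_saffari_shift _ N_u) zetaX_modD rmorphM.
rewrite mulrACA [Num.conj (w ^+ _) * _]mulrA conj_unimod ?mul1r; last first.
  by rewrite normrX norm_zeta expr1n.
by rewrite mulrC.
Qed.

Lemma corr_multiple (s j : Zmod D) : (N %| s)%N -> corr s j = w ^+ (s * j).
Proof.
by move=> N_s; rewrite /corr bjorck_saffari_shift // mulrA conj_unimod ?mul1r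
  ?norm_bjorck_saffari.
Qed.

Lemma sum_corr_eq0 a b m (s j : Zmod D) :
    D = (m * a)%N -> coprime a b -> s != 0 -> (D %| b * s)%N ->
  \sum_(k in multiples D a m) corr s (j - k) = 0.
Proof.
move=> Dma co_ab s_neq0 D_bs.
(* By coprimality, [gcd (a * s) (b * s) = s]. *)
have dvd_s d : (d %| D)%N -> (d %| a * s)%N -> (d %| s)%N.
  move=> d_D d_as; have := dvdn_gcd d (a * s) (b * s).
  by rewrite d_as (dvdn_trans d_D D_bs) -muln_gcdl (eqP co_ab) mul1n.
have shift_sum_eq0 t : (a %| t)%N -> ~~ (D %| t * s)%N ->
    (forall i, corr s (i + inZp t) = w ^+ (t * s) * corr s i) ->
    \sum_(k in multiples D a m) corr s (j - k) = 0.
  move=> a_t D_ts shiftE.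
  (* The sign of [u] is negative because the summation index enters as [j - k]. *)
  apply: (sum_multiples_eq0 D_gt0 Dma (u := - inZp t) (z := w ^+ (t * s))).
  - by rewrite multiplesN // mem_multiples_inZp.
  - by rewrite -(prim_order_dvd w_prim).
  - by move=> k; rewrite opprD opprK addrA shiftE.
have w_inZp t : w ^+ ((inZp t : Zmod D) * s) = w ^+ (t * s).
  by apply/eqP; rewrite (eq_prim_root_expr w_prim1) /= modnMml.
have [N_s|N_s] := boolP (N %| s)%N.
  apply: (shift_sum_eq0 a) => // [|i].
    apply: contra s_neq0 => D_as; have := dvd_s D (dvdnn _) D_as.
    by rewrite /dvdn modn_small // -[ltnRHS]modulusE.
  rewrite !corr_multiple // zetaX_modD mulrC; congr (_ * _).
  by rewrite mulnC w_inZp.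
apply: (shift_sum_eq0 (a * N)%N) => [||i]; first exact: dvdn_mulr.
(* Cancelling one [N] from [D = N * N] leaves the condition that [N] divides [a * s]. *)
- rewrite mulnAC {1}DE dvdn_pmul2r //; apply: contra N_s; apply: dvd_s.
  by rewrite DE dvdn_mulr.
- rewrite corr_shift ?w_inZp //= modulusE.
  by rewrite /dvdn modn_dvdm ?DE ?dvdn_mulr // modnMl.
Qed.

(** In matrix terms, the frame operator is [m * n] times the identity. *)
Lemma gabor_gram a b m n (j j' : Zmod D) :
    D = (m * a)%N -> D = (n * b)%N -> coprime a b ->
  \sum_(k in multiples D a m) \sum_(l in multiples D b n)
    Num.conj (gabor phi (k, l) j) * gabor phi (k, l) j' =
  (j == j')%:R * (m * n)%:R.
Proof.
move=> Dma Dnb co_ab.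
have [s j'E] : exists s, j' = j + s by exists (j' - j); rewrite addrC subrK.
(* The modulation phases at [j] and [j + s] cancel up to a factor without [k], so the double sum
   splits into a product. *)
have termE k l : Num.conj (gabor phi (k, l) j) * gabor phi (k, l) j' =
    corr s (j - k) * w ^+ (l * s).
  rewrite /gabor /modulation /translation /= !expi_zeta -/w rmorphM.
  rewrite /corr -addrAC -j'E mulrACA mulrC; congr (_ * _).
  rewrite j'E ![(_ * l)%N]mulnC zetaX_modD mulrA conj_unimod ?mul1r //.
  by rewrite normrX norm_zeta expr1n.
under eq_bigr do under eq_bigr do rewrite termE.
under eq_bigr do rewrite -mulr_sumr.
rewrite -mulr_suml.
have -> : (j == j') = (s == 0) by rewrite j'E eq_sym -subr_eq0 addrAC subrr add0r.
(* On the diagonal every term is 1, and the sums count the two subgroups. *)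
have [->|s_neq0] := eqVneq s 0.
  under eq_bigr do rewrite /corr addr0 conj_unimod ?norm_bjorck_saffari //.
  under [X in _ * X]eq_bigr do rewrite muln0 expr0.
  by rewrite !sumr_const (card_multiples D_gt0 Dma) (card_multiples D_gt0 Dnb)
     mul1r natrM.
rewrite mul0r.
have [D_bs|D_bs] := boolP (D %| b * s)%N.
  by rewrite (sum_corr_eq0 _ Dma co_ab) ?mul0r.
rewrite [X in _ * X](_ : _ = 0) ?mulr0 //.
apply: (sum_multiples_eq0 D_gt0 Dnb (u := inZp b) (z := w ^+ (b * s))) => [||l].
- by rewrite mem_multiples_inZp.
- by rewrite -(prim_order_dvd w_prim).
- rewrite -exprD; apply/eqP; rewrite (eq_prim_root_expr w_prim1) /=.
  by rewrite -mulnDl modnDmr modnMml addnC.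
Qed.

End BjorckSaffari.

(** * From the Gram kernel to the tight frame identity *)

Lemma norm2_sqr (R : realType) D (x : Zmod D -> R[i]) :
  norm2 x ^+ 2 = \sum_j x j * Num.conj (x j).
Proof. by rewrite sqrtCK; under eq_bigr do rewrite normCK. Qed.

Theorem proposition5p4 (R : realType) (N : nat) (hN : (0 < N)%N)
    (c : Zmod N -> R[i]) (hc : forall h : Zmod N, `|c h| = 1)
    (a b N' : nat) (ha : (0 < a)%N) (hb : (0 < b)%N) (hN' : (0 < N')%N)
    (hab : coprime a b) (hN2 : (N ^ 2 = a * b * N')%N) :
  let phi := bjorck_saffari c (1%g : {perm (Zmod N)}) in
  let K := multiples (N ^ 2) a (b * N') in
  let L := multiples (N ^ 2) b (a * N') in
  tight_frame (setX K L) (gabor phi) ((N ^ 2 * N')%N%:R : R).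
Proof.
move=> phi K L; split; first by rewrite ltr0n muln_gt0 expn_gt0 hN.
have sizeK : (N ^ 2 = b * N' * a)%N by rewrite hN2; ring.
have sizeL : (N ^ 2 = a * N' * b)%N by rewrite hN2; ring.
have sizeKL : (b * N' * (a * N') = N ^ 2 * N')%N by rewrite hN2; ring.
have gram j j' : \sum_(k in K) \sum_(l in L)
      Num.conj (gabor phi (k, l) j) * gabor phi (k, l) j' =
    (j == j')%:R * (b * N' * (a * N'))%:R.
  exact: (gabor_gram hN hc j j' sizeK sizeL hab).
move=> x; rewrite norm2_sqr rmorph_nat -sizeKL.
(* Each squared inner product is expanded as a double sum over [j] and [j'], and the sum over the
   system is moved inside. *)
transitivity (\sum_j \sum_j' x j * Num.conj (x j') *
    \sum_(k in K) \sum_(l in L)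
      Num.conj (gabor phi (k, l) j) * gabor phi (k, l) j').
  under [RHS]eq_bigr do under eq_bigr do rewrite pair_big_dep mulr_sumr.
  under [RHS]eq_bigr do rewrite exchange_big.
  rewrite exchange_big; apply: eq_big => [[k l]|[k l] _] /=; first by rewrite in_setX.
  rewrite normCK /inner rmorph_sum big_distrlr /=.
  apply: eq_bigr => j _; apply: eq_bigr => j' _.
  by rewrite [Num.conj (x j' * _)]rmorphM /= conjCK mulrACA.
rewrite mulr_sumr; apply: eq_bigr => j _; under eq_bigr do rewrite gram.
rewrite (bigD1 j) //= big1 => [|j' neq]; first by rewrite eqxx mul1r addr0 mulrC.
by rewrite eq_sym (negPf neq) mul0r mulr0.
Qed.
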